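(* Let $D$ be an integral domain and let $R$ be a pseudo-polynomial retract $D$-algebra. Let $\Theta$ be a complete family of flat overrings of $D$. Then there are exact sequences $$0\longrightarrow\mathrm{Pic}(D,\Theta)\longrightarrow\mathrm{Pic}(R)\xrightarrow{\ \pi_\Theta\ }\prod_{T\in\Theta}\mathrm{Pic}(RT)$$ and $$0\longrightarrow\mathrm{Pic}(D,\Theta)\longrightarrow\mathrm{Pic}_u(R,D)\xrightarrow{\ \pi_\Theta\ }\prod_{T\in\Theta}\mathrm{Pic}_u(RT,T),$$ where the first maps are induced by extension of ideals $[I]\mapsto[IR]$ and $\pi_\Theta$ is the extension map $[I]\mapsto([IRT])_{T\in\Theta}$.
   Context: All rings are commutative with unit; $D$ is an integral domain that is not a field, with quotient field $K\neq D$. If $A\subseteq B$ are integral domains, the quotient field of $A$ is viewed inside the quotient field of $B$. A fractional ideal of a domain $B$ is a $B$-submodule $I$ of its quotient field with $bI\subseteq B$ for some nonzero $b\in B$; it is integral if $I\subseteq B$. $\mathrm{Inv}(B)$ is the group of invertible fractional ideals of $B$, $\mathrm{Princ}(B)$ the subgroup of nonzero principal fractional ideals, $\mathrm{Pic}(B)=\mathrm{Inv}(B)/\mathrm{Princ}(B)$, and $[I]$ is the class of $I$. A retract $D$-algebra is a $D$-algebra $R$ that is an integral domain and admits a $D$-algebra homomorphism $\epsilon:R\to D$ (then $D\subseteq R$). For an extension $A\subseteq B$ of integral domains, with $F$ the quotient field of $A$: a fractional ideal $I$ of $B$ is unitary with respect to $A$ if $I\cap F\neq(0)$. $\mathrm{Inv}_u(B,A)$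 is the subgroup of $\mathrm{Inv}(B)$ generated by the invertible ideals that are both integral and unitary with respect to $A$; $\mathrm{Pic}_u(B,A):=\mathrm{Inv}_u(B,A)/(\mathrm{Inv}_u(B,A)\cap\mathrm{Princ}(B))$, a subgroup of $\mathrm{Pic}(B)$. $B$ is pseudo-polynomial over $A$ (a pseudo-polynomial $A$-algebra) if every principal integral ideal of $B$ that is unitary with respect to $A$ is generated by an element of $A$. An overring of $D$ is a ring between $D$ and $K$; it is flat if it is flat as a $D$-module. $RT$ is the subring of the quotient field of $R$ consisting of finite sums $\sum r_it_i$ with $r_i\in R$, $t_i\in T$. A family $\Theta$ of overrings is complete if $I=\bigcap_{T\in\Theta}IT$ for every ideal $I$ of $D$. $\mathrm{Pic}(D,\Theta)$ is the subgroup of $\mathrm{Pic}(D)$ of classes $[I]$ such that $IT$ is principal for every $T\in\Theta$. *)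

(* Defs.v *)
From HB Require Import structures.
From mathcomp Require Import all_boot all_order all_algebra.
From mathcomp Require Import generic_quotient ring_quotient fraction.
From mathcomp Require Import boolp classical_sets functions.

Set Implicit Arguments.
Unset Strict Implicit.
Unset Printing Implicit Defensive.

Import GRing.Theory Quotient.Exports.
Local Open Scope classical_set_scope.
Local Open Scope quotient_scope.
Local Open Scope ring_scope.

(** MathComp's commutative groups are additive ([zmodType]), so the groups of
    invertible ideals and the Picard groups are written additively: the sum of
    two invertible ideals is their product, and the zero is the unit ideal. *)

Record subgrp (V : zmodType) (S : zmodClosed V) := Subgrp {
  subgrp_val : V;
  subgrp_valP : subgrp_val \in S }.

Section SubgroupType.
Variables (V : zmodType) (S : zmodClosed V).
HB.instance Definition _ := [isSub for @subgrp_val V S].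
HB.instance Definition _ := [Choice of subgrp S by <:].
HB.instance Definition _ := [SubChoice_isSubZmodule of subgrp S by <:].

Lemma subgrp_val_additive : zmod_morphism (@subgrp_val V S).
Proof. exact: (raddfB (val : subgrp S -> V)). Qed.
HB.instance Definition _ :=
  GRing.isZmodMorphism.Build (subgrp S) V (@subgrp_val V S) subgrp_val_additive.
End SubgroupType.

(** [P] need not be contained in [S]: this is [S :&: P], inside [S]. *)
Definition trace_pred (V : zmodType) (S P : zmodClosed V) : {pred subgrp S} :=
  fun x => subgrp_val x \in P.

Section Trace.
Variables (V : zmodType) (S P : zmodClosed V).
Lemma trace_zmod_closed : zmod_closed (trace_pred (S := S) P).
Proof.
split=> [|x y xP yP]; rewrite -topredE /= /trace_pred.
  by rewrite raddf0 rpred0.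
by rewrite raddfB rpredB.
Qed.
HB.instance Definition _ :=
  GRing.isZmodClosed.Build (subgrp S) (trace_pred (S := S) P) trace_zmod_closed.
Definition trace : zmodClosed (subgrp S) := trace_pred (S := S) P.
End Trace.

(** [repr c] is a chosen representative of [c]; [quot_map_pi] below shows that
    the choice does not matter. *)
Definition quot_map (V W : zmodType) (P : zmodClosed V) (Q : zmodClosed W)
    (f : {additive V -> W}) (fPQ : forall x, x \in P -> f x \in Q)
    (c : Quotient.quot P) : Quotient.quot Q :=
  \pi_(Quotient.quot Q) (f (repr c)).

Section QuotMap.
Variables (V W : zmodType) (P : zmodClosed V) (Q : zmodClosed W).
Variables (f : {additive V -> W}) (fPQ : forall x, x \in P -> f x \in Q).

Lemma quot_map_pi (x : V) :
  quot_map fPQ (\pi_(Quotient.quot P) x) = \pi_(Quotient.quot Q) (f x).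
Proof.
apply/eqP; rewrite -Quotient.idealrBE -raddfB; apply: fPQ.
by rewrite Quotient.idealrBE reprK.
Qed.

Lemma quot_map_additive : zmod_morphism (quot_map fPQ).
Proof.
move=> a b; rewrite -[a]reprK -[b]reprK -raddfB !quot_map_pi.
by rewrite raddfB raddfB.
Qed.
HB.instance Definition _ :=
  GRing.isZmodMorphism.Build (Quotient.quot P) (Quotient.quot Q)
    (quot_map fPQ) quot_map_additive.
End QuotMap.

Definition prod_grp (I : Type) (G : I -> zmodType) : Type := forall i, G i.

Section ProdGroup.
Variables (I : Type) (G : I -> zmodType).
Implicit Types x y z : prod_grp G.
HB.instance Definition _ := gen_eqMixin (prod_grp G).
HB.instance Definition _ := gen_choiceMixin (prod_grp G).

Definition prod_zero : prod_grp G := fun=> 0.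
Definition prod_opp x : prod_grp G := fun i => - x i.
Definition prod_add x y : prod_grp G := fun i => x i + y i.

Lemma prod_addA : associative prod_add.
Proof. by move=> x y z; apply: functional_extensionality_dep => i; exact: addrA. Qed.
Lemma prod_addC : commutative prod_add.
Proof. by move=> x y; apply: functional_extensionality_dep => i; exact: addrC. Qed.
Lemma prod_add0 : left_id prod_zero prod_add.
Proof. by move=> x; apply: functional_extensionality_dep => i; exact: add0r. Qed.
Lemma prod_addN : left_inverse prod_zero prod_opp prod_add.
Proof. by move=> x; apply: functional_extensionality_dep => i; exact: addNr. Qed.
HB.instance Definition _ :=
  GRing.isZmodule.Build (prod_grp G) prod_addA prod_addC prod_add0 prod_addN.

Variables (V : zmodType) (f : forall i, {additive V -> G i}).
Definition prod_map (v : V) : prod_grp G := fun i => f i v.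
Lemma prod_map_additive : zmod_morphism prod_map.
Proof.
by move=> x y; apply: functional_extensionality_dep => i; exact: raddfB.
Qed.
HB.instance Definition _ :=
  GRing.isZmodMorphism.Build V (prod_grp G) prod_map prod_map_additive.
End ProdGroup.

Definition left_exact (U V W : zmodType)
    (f : {additive U -> V}) (g : {additive V -> W}) : Prop :=
  injective f /\ forall v, g v = 0 <-> exists u, f u = v.

(** The tensor product of [M] and [N] is the set of formal sums of pure
    tensors (lists of pairs) modulo the congruence [tensor_eq]; it is a group
    as the class of [(- m, n)] is opposite to that of [(m, n)]. *)

Inductive tensor_eq (A : comNzRingType) (M N : lmodType A) :
    seq (M * N) -> seq (M * N) -> Prop :=
| TensorRefl s : tensor_eq s s
| TensorSym s t : tensor_eq s t -> tensor_eq t s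
| TensorTrans s t u : tensor_eq s t -> tensor_eq t u -> tensor_eq s u
| TensorCat s s' t t' :
    tensor_eq s s' -> tensor_eq t t' -> tensor_eq (s ++ t) (s' ++ t')
| TensorCatC s t : tensor_eq (s ++ t) (t ++ s)
| TensorZero n : tensor_eq [:: (0, n)] [::]
| TensorAddl m m' n : tensor_eq [:: (m + m', n)] [:: (m, n); (m', n)]
| TensorAddr m n n' : tensor_eq [:: (m, n + n')] [:: (m, n); (m, n')]
| TensorScale a m n : tensor_eq [:: (a *: m, n)] [:: (m, a *: n)].

Definition flat (A : comNzRingType) (M : lmodType A) : Prop :=
  forall (N N' : lmodType A) (f : {linear N -> N'}), injective f ->
  forall s t : seq (M * N),
    tensor_eq [seq (p.1, f p.2) | p <- s] [seq (p.1, f p.2) | p <- t] ->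
    tensor_eq s t.

Section Ideals.
Variable L : fieldType.
Implicit Types (A B : subringClosed L) (I J : set L).

(** The quotient field of [B], inside [L]. *)
Definition qf B : set L :=
  [set x | exists a b, [/\ a \in B, b \in B, b != 0 & x = a / b]].

(** Finite sums of products: the product of two ideals, the extension [IB] of
    an ideal to a larger ring, and the ring [RT] are all of this form. *)
Definition smul I J : set L :=
  [set x | exists2 s : seq (L * L),
     (forall p, p \in s -> I p.1 /\ J p.2) & x = \sum_(p <- s) p.1 * p.2].

Definition cyclic_mod B (x : L) : set L := [set x * b | b in [set` B]].

Definition fractional B I : Prop :=
  [/\ [/\ I 0, (forall x y, I x -> I y -> I (x + y))
        & forall b x, b \in B -> I x -> I (b * x)],
      I `<=` qf B
    & exists b, [/\ b \in B, b != 0 & forall x, I x -> b * x \in B]].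

Definition integral B I : Prop := fractional B I /\ I `<=` [set` B].

Definition principal B I : Prop :=
  exists x, [/\ qf B x, x != 0 & I = cyclic_mod B x].

Definition unitary A I : Prop := exists x, [/\ I x, qf A x & x != 0].

Definition pseudo_polynomial B A : Prop :=
  forall f, f \in B -> unitary A (cyclic_mod B f) ->
  exists2 a, a \in A & cyclic_mod B f = cyclic_mod B a.

Definition invertible B I : Prop :=
  fractional B I /\ exists2 J, fractional B J & smul I J = [set` B].

Lemma smul0 I J : smul I J 0.
Proof. by exists [::] => //; rewrite big_nil. Qed.

Lemma smulD I J x y : smul I J x -> smul I J y -> smul I J (x + y).
Proof.
move=> [s sIJ ->] [t tIJ ->]; exists (s ++ t); last by rewrite big_cat.
by move=> p; rewrite mem_cat => /orP[/sIJ|/tIJ].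
Qed.

Lemma smulM I J x y : I x -> J y -> smul I J (x * y).
Proof.
move=> Ix Jy; exists [:: (x, y)]; last by rewrite big_seq1.
by move=> p; rewrite inE => /eqP ->.
Qed.

Lemma smul_sub I J (K : set L) : K 0 -> (forall x y, K x -> K y -> K (x + y)) ->
  (forall x y, I x -> J y -> K (x * y)) -> smul I J `<=` K.
Proof.
move=> K0 KD KM _ [s sIJ ->]; rewrite big_seq; apply: big_ind => //.
by move=> p /sIJ[]; exact: KM.
Qed.

Lemma smulC I J : smul I J = smul J I.
Proof.
suff H I' J' : smul I' J' `<=` smul J' I' by apply/seteqP; split; exact: H.
apply: smul_sub; [exact: smul0 | exact: smulD | move=> x y ? ?].
by rewrite mulrC; exact: smulM.
Qed.

Lemma smulA I J (K : set L) : smul I (smul J K) = smul (smul I J) K.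
Proof.
suff H I' J' K' : smul I' (smul J' K') `<=` smul (smul I' J') K'.
  apply/seteqP; split; first exact: H.
  by rewrite smulC (smulC I J) (smulC I) (smulC J K); exact: H.
apply: smul_sub; [exact: smul0 | exact: smulD | move=> x y Ix].
move: y; apply: (smul_sub (K := fun y => smul (smul I' J') K' (x * y))).
- by rewrite mulr0; exact: smul0.
- by move=> y z; rewrite mulrDr; exact: smulD.
- by move=> y z Jy Kz; rewrite mulrA; apply: smulM => //; exact: smulM.
Qed.

Lemma smulCA I J (K : set L) : smul I (smul J K) = smul J (smul I K).
Proof. by rewrite !smulA (smulC I). Qed.

Lemma smulACA I J (K M : set L) :
  smul (smul I J) (smul K M) = smul (smul I K) (smul J M).
Proof. by rewrite -!smulA (smulCA J). Qed.

Lemma smul_ringl A B : {subset A <= B} -> smul [set` A] [set` B] = [set` B].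
Proof.
move=> sAB; apply/seteqP; split=> [|x Bx].
  apply: smul_sub => [|x y|x y] /=; [exact: rpred0 | exact: rpredD |].
  by move=> /sAB; exact: rpredM.
by rewrite -[x]mul1r; apply: smulM => //=; exact: rpred1.
Qed.

Lemma smul_fractional B I : fractional B I -> smul I [set` B] = I.
Proof.
move=> [[I0 ID IM] _ _]; apply/seteqP; split=> [|x Ix].
  by apply: smul_sub => // x b Ix /= Bb; rewrite mulrC; exact: IM.
by rewrite -[x]mulr1; apply: smulM => //=; exact: rpred1.
Qed.

Lemma qf_ring B x : x \in B -> qf B x.
Proof. by move=> Bx; exists x, 1; rewrite rpred1 oner_eq0 divr1. Qed.

Lemma qf0 B : qf B 0. Proof. by apply: qf_ring; exact: rpred0. Qed.

Lemma qfD B x y : qf B x -> qf B y -> qf B (x + y).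
Proof.
move=> [a [b [Ba Bb b0 ->]]] [c [d [Bc Bd d0 ->]]].
exists (a * d + c * b), (b * d).
by rewrite mulf_neq0 ?addf_div // rpredD ?rpredM.
Qed.

Lemma qfM B x y : qf B x -> qf B y -> qf B (x * y).
Proof.
move=> [a [b [Ba Bb b0 ->]]] [c [d [Bc Bd d0 ->]]].
by exists (a * c), (b * d); rewrite mulf_neq0 ?mulf_div // !rpredM.
Qed.

Lemma qfV B x : qf B x -> qf B x^-1.
Proof.
move=> [a [b [Ba Bb b0 ->]]]; have [->|a0] := eqVneq a 0.
  by rewrite mul0r invr0; exact: qf0.
by exists b, a; rewrite invf_div.
Qed.

Lemma qf_mono A B : {subset A <= B} -> qf A `<=` qf B.
Proof. by move=> sAB x [a [b [/sAB Ba /sAB Bb b0 ->]]]; exists a, b. Qed.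

Lemma fractional_smul B I J :
  fractional B I -> fractional B J -> fractional B (smul I J).
Proof.
move=> [[I0 ID IM] IK [b [Bb b0 bI]]] [[J0 JD JM] JK [c [Bc c0 cJ]]]; split.
- split; [exact: smul0 | exact: smulD | move=> d x Bd].
  move: x; apply: (smul_sub (K := fun x => smul I J (d * x))).
  + by rewrite mulr0; exact: smul0.
  + by move=> x y; rewrite mulrDr; exact: smulD.
  + by move=> x y Ix Jy; rewrite mulrA; apply: smulM => //; exact: IM.
- apply: smul_sub; [exact: qf0 | exact: qfD | move=> x y Ix Jy].
  by apply: qfM; [exact: IK | exact: JK].
- exists (b * c); split; [exact: rpredM | exact: mulf_neq0 |].
  apply: (smul_sub (K := fun x => b * c * x \in B)).
  + by rewrite mulr0 rpred0.
  + by move=> x y Bx By; rewrite mulrDr rpredD.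
  + by move=> x y Ix Jy; rewrite mulrACA rpredM ?bI ?cJ.
Qed.

Lemma fractional_cyclic B x : qf B x -> fractional B (cyclic_mod B x).
Proof.
move=> qx; split.
- split; first by exists 0; rewrite /= ?rpred0 ?mulr0.
    move=> _ _ [b /= Bb <-] [c /= Bc <-].
    by exists (b + c); rewrite /= ?rpredD ?mulrDr.
  move=> b _ Bb [c /= Bc <-]; exists (b * c); first exact: rpredM.
  by rewrite mulrCA.
- by move=> _ [b /= Bb <-]; apply: qfM => //; exact: qf_ring.
- case: qx => [a [b [Ba Bb b0 ->]]]; exists b; split=> // _ [c /= Bc <-].
  by rewrite mulrA mulrCA divff // mulr1 rpredM.
Qed.

Lemma fractional_ring B : fractional B [set` B].
Proof.
have -> : [set` B] = cyclic_mod B 1.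
  apply/seteqP; split=> [b Bb|_ [b Bb <-]]; last by rewrite mul1r.
  by exists b; rewrite ?mul1r.
by apply: fractional_cyclic; apply: qf_ring; exact: rpred1.
Qed.

Lemma smul_cyclic B x y :
  smul (cyclic_mod B x) (cyclic_mod B y) = cyclic_mod B (x * y).
Proof.
apply/seteqP; split.
  apply: smul_sub.
  - by exists 0; rewrite /= ?rpred0 ?mulr0.
  - move=> _ _ [b /= Bb <-] [c /= Bc <-].
    by exists (b + c); rewrite /= ?rpredD ?mulrDr.
  - move=> _ _ [b /= Bb <-] [c /= Bc <-]; exists (b * c).
      exact: rpredM.
    by rewrite mulrACA.
move=> _ [b /= Bb <-]; rewrite -mulrA; apply: smulM.
  by exists 1; rewrite ?mulr1 //=; exact: rpred1.
by exists b.
Qed.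

Lemma cyclic_mod1 B : cyclic_mod B 1 = [set` B].
Proof.
apply/seteqP; split=> [_ [b Bb <-]|b Bb]; first by rewrite mul1r.
by exists b; rewrite ?mul1r.
Qed.

Lemma principal_ring B : principal B [set` B].
Proof.
exists 1; rewrite oner_neq0 cyclic_mod1; split=> //.
by apply: qf_ring; exact: rpred1.
Qed.

Lemma smul_ext A B I J : {subset A <= B} ->
  smul (smul I [set` B]) (smul J [set` B]) = smul (smul I J) [set` B].
Proof. by move=> sAB; rewrite smulACA smul_ringl. Qed.

Lemma fractional_ext A B I :
  {subset A <= B} -> fractional A I -> fractional B (smul I [set` B]).
Proof.
move=> sAB [[I0 ID IM] IK [b [Ab b0 bI]]]; split.
- split; [exact: smul0 | exact: smulD | move=> d x Bd].
  move: x; apply: (smul_sub (K := fun x => smul I _ (d * x))).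
  + by rewrite mulr0; exact: smul0.
  + by move=> x y; rewrite mulrDr; exact: smulD.
  + by move=> x y Ix By; rewrite mulrCA; apply: smulM => //; exact: rpredM.
- apply: smul_sub; [exact: qf0 | exact: qfD | move=> x y Ix By].
  by apply: qfM; [exact: (qf_mono sAB (IK _ Ix)) | exact: qf_ring].
- exists b; split=> //; first exact: sAB.
  apply: (smul_sub (K := fun x => b * x \in B)).
  + by rewrite mulr0 rpred0.
  + by move=> x y Bx By; rewrite mulrDr rpredD.
  + by move=> x y Ix By; rewrite mulrA rpredM //; exact/sAB/bI.
Qed.

Lemma invertible_ext A B I :
  {subset A <= B} -> invertible A I -> invertible B (smul I [set` B]).
Proof.
move=> sAB [fI [J fJ IJ]]; split; first exact: (fractional_ext sAB fI).
exists (smul J [set` B]); first exact: (fractional_ext sAB fJ).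
by rewrite (smul_ext _ _ sAB) IJ smul_ringl.
Qed.

Lemma cyclic_ext A B x : {subset A <= B} ->
  smul (cyclic_mod A x) [set` B] = cyclic_mod B x.
Proof.
move=> sAB; apply/seteqP; split.
  apply: smul_sub.
  - by exists 0; rewrite /= ?rpred0 ?mulr0.
  - move=> _ _ [b /= Bb <-] [c /= Bc <-].
    by exists (b + c); rewrite /= ?rpredD ?mulrDr.
  - move=> _ y [a /= /sAB Ba <-] By; exists (a * y); last by rewrite mulrA.
    exact: rpredM.
move=> _ [b Bb <-]; apply: smulM => //; exists 1; last exact: mulr1.
exact: rpred1.
Qed.

Lemma principal_ext A B I :
  {subset A <= B} -> principal A I -> principal B (smul I [set` B]).
Proof.
move=> sAB [x [qx x0 ->]]; exists x; rewrite cyclic_ext //; split=> //.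
exact: qf_mono sAB _ qx.
Qed.

Record inv B := Inv { inv_set :> set L; invP : invertible B inv_set }.

Lemma inv_inj B (I J : inv B) : inv_set I = inv_set J -> I = J.
Proof.
case: I J => I PI [J PJ] /= IJ; rewrite IJ in PI *.
by congr Inv; exact: Prop_irrelevance.
Qed.

HB.instance Definition _ B := gen_eqMixin (inv B).
HB.instance Definition _ B := gen_choiceMixin (inv B).

Lemma inv_one_subproof B : invertible B [set` B].
Proof.
split; first exact: fractional_ring.
by exists [set` B]; [exact: fractional_ring | exact: smul_ringl].
Qed.
Definition inv_one B : inv B := Inv (@inv_one_subproof B).

Lemma inv_mul_subproof B (I J : inv B) : invertible B (smul I J).
Proof.
case: I J => I [fI [I' fI' II']] [J [fJ [J' fJ' JJ']]] /=.
split; first exact: fractional_smul.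
exists (smul I' J'); first exact: fractional_smul.
by rewrite smulACA II' JJ' smul_ringl.
Qed.
Definition inv_mul B (I J : inv B) : inv B := Inv (inv_mul_subproof I J).

Lemma inv_inverse_subproof B (I : inv B) :
  exists J : inv B, smul J I = [set` B].
Proof.
case: I => I [fI [J fJ IJ]] /=.
by exists (Inv (conj fJ (ex_intro2 _ _ I fI (etrans (smulC J I) IJ))));
  rewrite /= smulC.
Qed.
Definition inv_inverse B (I : inv B) : inv B :=
  projT1 (cid (inv_inverse_subproof I)).

Section InvGroup.
Variable B : subringClosed L.
Lemma inv_mulA : associative (@inv_mul B).
Proof. by move=> I J K; apply: inv_inj; exact: smulA. Qed.
Lemma inv_mulC : commutative (@inv_mul B).
Proof. by move=> I J; apply: inv_inj; exact: smulC. Qed.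
Lemma inv_mul1 : left_id (inv_one B) (@inv_mul B).
Proof.
move=> I; apply: inv_inj; rewrite /= smulC.
by apply: smul_fractional; case: (invP I).
Qed.
Lemma inv_mulV : left_inverse (inv_one B) (@inv_inverse B) (@inv_mul B).
Proof.
by move=> I; apply: inv_inj; exact: (projT2 (cid (inv_inverse_subproof I))).
Qed.
HB.instance Definition _ :=
  GRing.isZmodule.Build (inv B) inv_mulA inv_mulC inv_mul1 inv_mulV.
End InvGroup.

Lemma inv_setD B (I J : inv B) : inv_set (I + J) = smul I J.
Proof. by []. Qed.

Lemma inv_oppP B (I : inv B) (J : set L) :
  fractional B J -> smul J I = [set` B] -> inv_set (- I) = J.
Proof.
move=> fJ JI; have VI : smul (inv_set (- I)) I = [set` B].
  exact: (congr1 (@inv_set B) (addNr I)).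
rewrite -[RHS](smul_fractional fJ) -VI smulCA JI smul_fractional //.
by case: (invP (- I)).
Qed.

Definition princ_pred B : {pred inv B} := fun I : inv B => `[< principal B I >].

Lemma princ_zmod_closed B : zmod_closed (@princ_pred B).
Proof.
split=> [|I J /asboolP [x [qx x0 Ix]] /asboolP [y [qy y0 Jy]]].
  by apply/asboolP; exact: principal_ring.
apply/asboolP.
exists (x / y); split; first by apply: qfM => //; exact: qfV.
  by rewrite mulf_neq0 ?invr_eq0.
rewrite inv_setD Ix (@inv_oppP _ _ (cyclic_mod B y^-1)) ?smul_cyclic //.
  by apply: fractional_cyclic; exact: qfV.
by rewrite Jy smul_cyclic mulVf // cyclic_mod1.
Qed.
HB.instance Definition _ B :=
  GRing.isZmodClosed.Build (inv B) (@princ_pred B) (@princ_zmod_closed B).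
Definition Princ B : zmodClosed (inv B) := @princ_pred B.

Definition Pic B : zmodType := Quotient.quot (Princ B).

(** The generated subgroup, as the intersection of all subgroups containing the
    generators. *)
Definition inv_u_pred B A : {pred inv B} := fun I : inv B =>
  `[< forall S : zmodClosed (inv B),
        (forall J : inv B, integral B J -> unitary A J -> J \in S) -> I \in S >].

Lemma Inv_u_zmod_closed B A : zmod_closed (@inv_u_pred B A).
Proof.
split=> [|I J /asboolP HI /asboolP HJ].
  by apply/asboolP => S _; exact: rpred0.
apply/asboolP => S HS.
by rewrite rpredB ?HI ?HJ.
Qed.
HB.instance Definition _ B A :=
  GRing.isZmodClosed.Build (inv B) (@inv_u_pred B A) (@Inv_u_zmod_closed B A).
Definition Inv_u B A : zmodClosed (inv B) := @inv_u_pred B A.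

Definition Pic_u B A : zmodType :=
  Quotient.quot (trace (Inv_u B A) (Princ B)).

Definition inv_ext A B (sAB : {subset A <= B}) (I : inv A) : inv B :=
  Inv (invertible_ext sAB (invP I)).

Lemma inv_ext_additive A B (sAB : {subset A <= B}) :
  zmod_morphism (inv_ext sAB).
Proof.
move=> I J; apply: (addIr (inv_ext sAB J)); rewrite subrK.
apply: inv_inj; apply: etrans (smul_ext (I - J)%R J sAB) _.
exact: (congr1 (fun K : inv A => smul K [set` B]) (subrK J I)).
Qed.
HB.instance Definition _ A B (sAB : {subset A <= B}) :=
  GRing.isZmodMorphism.Build (inv A) (inv B) (inv_ext sAB)
    (inv_ext_additive sAB).

Lemma inv_ext_princ A B (sAB : {subset A <= B}) (I : inv A) :
  I \in Princ A -> inv_ext sAB I \in Princ B.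
Proof. by move=> /asboolP HI; apply/asboolP; exact: (principal_ext sAB HI). Qed.

Definition Pic_ext A B (sAB : {subset A <= B}) : {additive Pic A -> Pic B} :=
  quot_map (inv_ext_princ sAB).

Lemma Pic_extE A B (sAB : {subset A <= B}) (I : inv A) :
  Pic_ext sAB (\pi_(Pic A) I) = \pi_(Pic B) (inv_ext sAB I).
Proof. exact: quot_map_pi. Qed.

Lemma unitary_mono A A' I J :
  {subset A <= A'} -> I `<=` J -> unitary A I -> unitary A' J.
Proof.
move=> sAA sIJ [x [Ix qx x0]]; exists x; split=> //; first exact: sIJ.
exact: qf_mono sAA _ qx.
Qed.

Lemma sub_ext B I : I `<=` smul I [set` B].
Proof.
by move=> x Ix; rewrite -[x]mulr1; apply: smulM => //; exact: rpred1.
Qed.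

Lemma integral_ext A B I :
  {subset A <= B} -> integral A I -> integral B (smul I [set` B]).
Proof.
move=> sAB [fI sI]; split; first exact: (fractional_ext sAB fI).
apply: smul_sub => [|x y|x y] /=; [exact: rpred0 | exact: rpredD |].
by move=> /sI /sAB; exact: rpredM.
Qed.

Lemma inv_neq0 B (I : inv B) : exists2 x, inv_set I x & x != 0.
Proof.
case: I => I [_ [J _ IJ]] /=; apply: contrapT => I0.
have : smul I J 1 by rewrite IJ; exact: rpred1.
suff sub : smul I J `<=` [set 0] by move=> /sub /eqP; rewrite oner_eq0.
apply: smul_sub => [//|x y /= -> ->|x y Ix _]; first by rewrite addr0.
have [->|x0] := eqVneq x 0; first by rewrite /= mul0r.
by case: I0; exists x.
Qed.

Lemma inv_integral_unitary B (I : inv B) : integral B I -> unitary B I.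
Proof.
move=> [_ sI]; have [x Ix x0] := inv_neq0 I.
by exists x; split=> //; apply: qf_ring; exact: sI.
Qed.

Lemma inv_u_ext A B (sAB : {subset A <= B}) (I : inv A) :
  inv_ext sAB I \in Inv_u B A.
Proof.
apply/asboolP => S HS.
have key (J : inv A) : integral A J -> inv_ext sAB J \in S.
  move=> iJ; apply: HS; first exact: integral_ext iJ.
  apply: unitary_mono (inv_integral_unitary iJ) => //; exact: sub_ext.
have [fI _] := invP I; case: (fI) => [[_ _ _] _ [b [Ab b0 bI]]].
have qb : qf A b by exact: qf_ring.
have fb := fractional_cyclic qb.
have ib : invertible A (cyclic_mod A b).
  split=> //; exists (cyclic_mod A b^-1).
    by apply: fractional_cyclic; exact: qfV.
  by rewrite smul_cyclic divff // cyclic_mod1.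
rewrite -[I](addrK (Inv ib)) raddfB rpredB //; apply: key.
  split; first by case: (invP (I + Inv ib)).
  rewrite inv_setD /=; apply: smul_sub => [|x y|x y] /=.
  - exact: rpred0.
  - exact: rpredD.
  - by move=> Ix [a /= Aa <-]; rewrite mulrCA mulrA rpredM ?bI.
by split=> // _ [a /= Aa <-]; exact: rpredM.
Qed.

Definition inv_to_u A B (sAB : {subset A <= B}) (I : inv A) :
  subgrp (Inv_u B A) := Subgrp (inv_u_ext sAB I).

Lemma inv_to_u_additive A B (sAB : {subset A <= B}) :
  zmod_morphism (inv_to_u sAB).
Proof. by move=> I J; apply: val_inj; rewrite /= !raddfB. Qed.
HB.instance Definition _ A B (sAB : {subset A <= B}) :=
  GRing.isZmodMorphism.Build (inv A) (subgrp (Inv_u B A)) (inv_to_u sAB)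
    (inv_to_u_additive sAB).

Lemma inv_to_u_princ A B (sAB : {subset A <= B}) (I : inv A) :
  I \in Princ A -> inv_to_u sAB I \in trace (Inv_u B A) (Princ B).
Proof. exact: inv_ext_princ. Qed.

Definition Pic_to_u A B (sAB : {subset A <= B}) :
    {additive Pic A -> Pic_u B A} :=
  quot_map (inv_to_u_princ sAB).

Lemma Pic_to_uE A B (sAB : {subset A <= B}) (I : inv A) :
  Pic_to_u sAB (\pi_(Pic A) I) = \pi_(Pic_u B A) (inv_to_u sAB I).
Proof. exact: quot_map_pi. Qed.

Section ExtU.
Variables A A' B B' : subringClosed L.
Hypotheses (sA : {subset A <= A'}) (sB : {subset B <= B'}).

Definition inv_ext_pre : {pred inv B} := fun I : inv B => inv_ext sB I \in Inv_u B' A'.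
Lemma inv_ext_pre_closed : zmod_closed inv_ext_pre.
Proof.
split=> [|I J HI HJ]; rewrite -topredE /= /inv_ext_pre.
  by rewrite raddf0 rpred0.
by rewrite raddfB rpredB.
Qed.
HB.instance Definition _ :=
  GRing.isZmodClosed.Build (inv B) inv_ext_pre inv_ext_pre_closed.

Lemma inv_ext_u_subproof (I : subgrp (Inv_u B A)) :
  inv_ext sB (subgrp_val I) \in Inv_u B' A'.
Proof.
have /asboolP/(_ inv_ext_pre) := subgrp_valP I; apply=> J iJ uJ.
apply/asboolP => S; apply; first exact: integral_ext iJ.
by apply: unitary_mono uJ => //; exact: sub_ext.
Qed.

Definition inv_ext_u (I : subgrp (Inv_u B A)) : subgrp (Inv_u B' A') :=
  Subgrp (inv_ext_u_subproof I).

Lemma inv_ext_u_additive : zmod_morphism inv_ext_u.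
Proof. by move=> I J; apply: val_inj; rewrite /= !raddfB. Qed.
HB.instance Definition _ :=
  GRing.isZmodMorphism.Build (subgrp (Inv_u B A)) (subgrp (Inv_u B' A'))
    inv_ext_u inv_ext_u_additive.

Lemma inv_ext_u_princ (I : subgrp (Inv_u B A)) :
  I \in trace (Inv_u B A) (Princ B) ->
  inv_ext_u I \in trace (Inv_u B' A') (Princ B').
Proof. exact: inv_ext_princ. Qed.

Definition Pic_u_ext : {additive Pic_u B A -> Pic_u B' A'} :=
  quot_map inv_ext_u_princ.

Lemma Pic_u_extE (I : subgrp (Inv_u B A)) :
  Pic_u_ext (\pi_(Pic_u B A) I) = \pi_(Pic_u B' A') (inv_ext_u I).
Proof. exact: quot_map_pi. Qed.
End ExtU.

Definition compositum A B : {pred L} :=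
  fun x => `[< smul [set` A] [set` B] x >].

Lemma compositum_closed A B : subring_closed (compositum A B).
Proof.
have N x : smul [set` A] [set` B] x -> smul [set` A] [set` B] (- x).
  move: x; apply: (smul_sub (K := fun x => smul _ _ (- x))).
  - by rewrite oppr0; exact: smul0.
  - by move=> x y; rewrite opprD; exact: smulD.
  - by move=> x y Ax By; rewrite -mulNr; apply: smulM; rewrite //= rpredN.
split=> [|x y /asboolP Hx /asboolP Hy|x y /asboolP Hx /asboolP Hy].
- apply/asboolP; rewrite -[1](mulr1 1).
  by apply: smulM; exact: rpred1.
- by apply/asboolP; apply: smulD => //; exact: N.
- apply/asboolP; rewrite -(smul_ringl (fun x => id : x \in A -> x \in A)).
  rewrite -[in X in smul _ X](smul_ringl (fun x => id : x \in B -> x \in B)).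
  by rewrite -smulACA; exact: smulM.
Qed.
HB.instance Definition _ A B :=
  GRing.isSubringClosed.Build L (compositum A B) (compositum_closed A B).

Lemma sub_compositum A B : {subset A <= compositum A B}.
Proof.
move=> x Ax; apply/asboolP; rewrite -[x]mulr1.
by apply: smulM => //; exact: rpred1.
Qed.

Definition rimage (S : nzRingType) (f : {rmorphism S -> L}) : {pred L} :=
  fun y => `[< exists x, y = f x >].

Lemma rimage_closed (S : nzRingType) (f : {rmorphism S -> L}) :
  subring_closed (rimage f).
Proof.
split=> [|x y /asboolP[a ->] /asboolP[b ->]|x y /asboolP[a ->] /asboolP[b ->]];
  apply/asboolP; first by exists 1; rewrite rmorph1.
- by exists (a - b); rewrite rmorphB.
- by exists (a * b); rewrite rmorphM.
Qed.
HB.instance Definition _ (S : nzRingType) (f : {rmorphism S -> L}) :=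
  GRing.isSubringClosed.Build L (rimage f) (rimage_closed f).

End Ideals.

(** [R] is a [D]-algebra through [iota]. Everything is viewed inside the
    quotient field of [R]. *)

Section Algebra.
Variables (D R : idomainType) (iota : {rmorphism D -> R}).
Local Notation L := {fraction R}.

Definition in_frac : {rmorphism D -> L} := @tofrac R \o iota.

Definition Rsub : subringClosed L := rimage (@tofrac R).
Definition Dsub : subringClosed L := rimage in_frac.

Lemma Dsub_Rsub : {subset Dsub <= Rsub}.
Proof. by move=> x /asboolP[d ->]; apply/asboolP; exists (iota d). Qed.

Record overring := Overring {
  ovr_ring :> subringClosed L;
  ovr_sup : {subset Dsub <= ovr_ring};
  ovr_sub : [set` ovr_ring] `<=` qf Dsub }.

Record ovr_mod (T : overring) := OvrMod {
  ovr_val : L;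
  ovr_valP : ovr_val \in ovr_ring T }.

Section OverringModule.
Variable T : overring.
HB.instance Definition _ := [isSub for @ovr_val T].
HB.instance Definition _ := [Choice of ovr_mod T by <:].
HB.instance Definition _ := [SubChoice_isSubZmodule of ovr_mod T by <:].

Lemma ovr_scale_subproof (d : D) (x : ovr_mod T) :
  in_frac d * ovr_val x \in ovr_ring T.
Proof.
apply: rpredM; last exact: ovr_valP.
by apply: ovr_sup; apply/asboolP; exists d.
Qed.
Definition ovr_scale (d : D) (x : ovr_mod T) : ovr_mod T :=
  OvrMod (ovr_scale_subproof d x).

Lemma ovr_scaleA a b x : ovr_scale a (ovr_scale b x) = ovr_scale (a * b) x.
Proof. by apply: val_inj; rewrite /= !rmorphM mulrA. Qed.
Lemma ovr_scale1 : left_id 1 ovr_scale.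
Proof. by move=> x; apply: val_inj; rewrite /= !rmorph1 mul1r. Qed.
Lemma ovr_scaleDr : right_distributive ovr_scale +%R.
Proof. by move=> a x y; apply: val_inj; rewrite /= mulrDr. Qed.
Lemma ovr_scaleDl x : {morph ovr_scale^~ x : a b / a + b}.
Proof. by move=> a b; apply: val_inj; rewrite /= !rmorphD mulrDl. Qed.
HB.instance Definition _ := GRing.Zmodule_isLmodule.Build D (ovr_mod T)
  ovr_scaleA ovr_scale1 ovr_scaleDr ovr_scaleDl.
End OverringModule.

Definition retract_algebra : Prop :=
  exists eps : {rmorphism R -> D}, cancel iota eps.

Definition flat_overring (T : overring) : Prop := flat (ovr_mod T : lmodType D).

Definition complete (Theta : set overring) : Prop :=
  forall I : set L, integral Dsub I ->
  I = \bigcap_(T in Theta) smul I [set` ovr_ring T].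

Definition RT (T : overring) : subringClosed L := compositum Rsub (ovr_ring T).

Lemma Rsub_RT T : {subset Rsub <= RT T}.
Proof. exact: sub_compositum. Qed.

Section Family.
Variable Theta : set overring.

Definition Pic_Theta_pred : {pred Pic Dsub} := fun c =>
  `[< exists2 I : inv Dsub, c = \pi_(Pic Dsub) I &
        forall T, Theta T -> principal (ovr_ring T) (smul I [set` ovr_ring T]) >].

Lemma Pic_Theta_closed : zmod_closed Pic_Theta_pred.
Proof.
split=> [|c d /asboolP[I -> HI] /asboolP[J -> HJ]]; apply/asboolP.
  exists 0; first by rewrite raddf0.
  by move=> T _; apply: principal_ext; [exact: ovr_sup | exact: principal_ring].
exists (I - J); first by rewrite raddfB.
move=> T TT; pose e : {additive inv Dsub -> inv (ovr_ring T)} := inv_ext (@ovr_sup T).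
suff /asboolP : e (I - J) \in Princ (ovr_ring T) by [].
by rewrite raddfB rpredB //; apply/asboolP; [exact: HI | exact: HJ].
Qed.
HB.instance Definition _ :=
  GRing.isZmodClosed.Build (Pic Dsub) Pic_Theta_pred Pic_Theta_closed.
Definition Pic_Theta_sub : zmodClosed (Pic Dsub) := Pic_Theta_pred.

Definition Pic_Theta : zmodType := subgrp Pic_Theta_sub.

Definition ext_R : {additive Pic_Theta -> Pic Rsub} :=
  Pic_ext Dsub_Rsub \o @subgrp_val _ Pic_Theta_sub.

Definition ext_R_u : {additive Pic_Theta -> Pic_u Rsub Dsub} :=
  Pic_to_u Dsub_Rsub \o @subgrp_val _ Pic_Theta_sub.

Definition pi_Theta : {additive Pic Rsub ->
    prod_grp (fun T : Theta => Pic (RT (val T)))} :=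
  prod_map (fun T : Theta => Pic_ext (@Rsub_RT (val T))).

Definition pi_Theta_u : {additive Pic_u Rsub Dsub ->
    prod_grp (fun T : Theta => Pic_u (RT (val T)) (ovr_ring (val T)))} :=
  prod_map (fun T : Theta => Pic_u_ext (@ovr_sup (val T)) (@Rsub_RT (val T))).

End Family.
End Algebra.

(* Main.v *)
From HB Require Import structures.
Require Import Defs.
From mathcomp Require Import all_boot all_order all_algebra.
From mathcomp Require Import generic_quotient ring_quotient fraction.
From mathcomp Require Import boolp classical_sets.

Set Implicit Arguments.
Unset Strict Implicit.
Unset Printing Implicit Defensive.

Import GRing.Theory Quotient.Exports.
Local Open Scope classical_set_scope.
Local Open Scope quotient_scope.
Local Open Scope ring_scope.

(** If [T] is a flat overring, every [t] in [T] has a denominator ideal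
    [(D : t)] that generates the unit ideal of [T].  Hence [(MT) \cap V] is
    contained in [(M \cap V)T] for all [D]-submodules [M], [V] of the ambient
    field, and completeness gives [M = \bigcap_T MT] for all submodules [M],
    not only for ideals of [D].

    Let [J] be an invertible ideal of [R] with all [JRT] principal.  Dividing
    by a generator of [JRT] for a single [T], we may assume that [J] and
    [J^-1] contain nonzero elements of [D]; as [R] is pseudo-polynomial, each
    [JRT] is then generated by some [a_T] in [K].  With [I = J \cap K] and
    [I' = J^-1 \cap K], one gets [IT = a_T T] and [I'T = a_T^-1 T] because
    [RT \cap K = T], and so [II' = D] and [IR = J] hold, being true after
    extension to every [T].  Here [K] is the quotient field of [D]. *)

(** * Submodules of a field and their denominator ideals *)

Section Colon.
Variables (L : fieldType) (A : subringClosed L).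
Implicit Types (M V : set L) (T : subringClosed L).

Definition submodule M : Prop :=
  [/\ M 0, forall x y, M x -> M y -> M (x + y)
    & forall a x, a \in A -> M x -> M (a * x)].

Definition colon M (x : L) : set L := [set c | c \in A /\ M (c * x)].

(** The ideal-theoretic form in which flatness enters the main argument; [flat_denominators] derives
    it from the tensor product. *)
Definition denominators_comaximal T : Prop :=
  forall t, t \in T -> smul (colon [set` A] t) [set` T] 1.

Lemma smul_mono (I I' J J' : set L) :
  I `<=` I' -> J `<=` J' -> (smul I J : set L) `<=` smul I' J'.
Proof.
move=> sI sJ; apply: smul_sub; [exact: smul0 | exact: smulD |].
by move=> x y /sI Ix /sJ Jy; exact: smulM.
Qed.

Lemma smul_ringr_id I T : smul (smul I [set` T]) [set` T] = smul I [set` T].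
Proof. by rewrite -smulA smul_ringl. Qed.

Lemma smul_submodule I M : submodule M -> submodule (smul I M).
Proof.
move=> [M0 MD MM]; split; [exact: smul0 | exact: smulD | move=> a x Aa].
move: x; apply: (smul_sub (K := fun x => smul I M (a * x))).
- by rewrite mulr0; exact: smul0.
- by move=> x y; rewrite mulrDr; exact: smulD.
- by move=> x y Ix My; rewrite mulrCA; apply: smulM => //; exact: MM.
Qed.

Lemma submoduleI M V : submodule M -> submodule V -> submodule (M `&` V).
Proof.
move=> [M0 MD MM] [V0 VD VM]; split=> //.
  by move=> x y [? ?] [? ?]; split; [exact: MD | exact: VD].
by move=> a x Aa [? ?]; split; [exact: MM | exact: VM].
Qed.

Lemma fractional_submodule M : fractional A M -> submodule M.
Proof. by case. Qed.

Lemma submodule_ring T : {subset A <= T} -> submodule [set` T].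
Proof.
move=> sAT; split=> [|x y|a x /sAT] /=; [exact: rpred0 | exact: rpredD |].
exact: rpredM.
Qed.

Lemma submodule_qf T : {subset A <= T} -> submodule (qf T).
Proof.
move=> sAT; split; [exact: qf0 | exact: qfD | move=> a x /sAT Ta].
by apply: qfM; exact: qf_ring.
Qed.

Lemma colon_ideal M x : submodule M -> integral A (colon M x).
Proof.
move=> [M0 MD MM]; split; last by move=> c [].
split.
- split; first by split; rewrite ?rpred0 ?mul0r.
    move=> b c [Ab Mb] [Ac Mc]; split; first exact: rpredD.
    by rewrite mulrDl; exact: MD.
  move=> a c Aa [Ac Mc]; split; first exact: rpredM.
  by rewrite -mulrA; exact: MM.
- by move=> c [Ac _]; exact: qf_ring.
- exists 1; rewrite rpred1 oner_neq0; split=> // c [Ac _].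
  by rewrite mul1r.
Qed.

(** For a sum, [(M : x)(M : y)] lies in [(M : x + y)], and a product of ideals generating [T] again
    generates [T]. For [m * t] with [m] in [M], [(A : t)] lies in [(M : m * t)]. *)
Lemma colon_comaximal T M : denominators_comaximal T -> submodule M ->
  forall x, smul M [set` T] x -> smul (colon M x) [set` T] 1.
Proof.
move=> dT [M0 MD MM]; apply: smul_sub.
- apply: sub_ext; split; first exact: rpred1.
  by rewrite mulr0.
- move=> x y Mx My; rewrite -[1](mul1r 1).
  rewrite -(smul_ringl (fun x => id : x \in T -> x \in T)).
  have := smulM Mx My; rewrite smulACA; apply: smul_mono => //.
  apply: smul_sub => [|b c|b c [Ab Mb] [Ac Mc]].
  + by split; rewrite ?rpred0 ?mul0r.
  + move=> [Ab Mb] [Ac Mc]; split; first exact: rpredD.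
    by rewrite mulrDl; exact: MD.
  + split; first exact: rpredM.
    rewrite mulrDr; apply: MD; last by rewrite -mulrA; exact: MM.
    by rewrite (mulrC b) -mulrA; exact: MM.
- move=> m t Mm /= /dT; apply: smul_mono => // c [Ac Act]; split=> //.
  by rewrite mulrCA mulrC; exact: MM.
Qed.

(* If the elements [c] of [colon M x] generate the unit ideal of [T], then [x]
   is a [T]-combination of the products [c * x], which lie in both [M] and [V]. *)
Lemma smul_capr T M V x : denominators_comaximal T ->
  submodule M -> submodule V ->
  smul M [set` T] x -> V x -> smul (M `&` V) [set` T] x.
Proof.
move=> dT sM [_ _ VM] Mx Vx; rewrite -[x]mulr1.
move: 1 (colon_comaximal dT sM Mx).
apply: (smul_sub (K := fun y => smul (M `&` V) _ (x * y))).
- by rewrite mulr0; exact: smul0.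
- by move=> y z; rewrite mulrDr; exact: smulD.
- move=> c t [Ac Mc] Tt; rewrite mulrA; apply: smulM => //.
  by rewrite mulrC; split=> //; exact: VM.
Qed.

Lemma clear_denominator T M : submodule M -> [set` T] `<=` qf A ->
  forall x, smul M [set` T] x -> exists d, [/\ d \in A, d != 0 & M (d * x)].
Proof.
move=> [M0 MD MM] qT; apply: smul_sub.
- by exists 1; rewrite rpred1 oner_neq0 mulr0.
- move=> x y [b [Ab b0 Mb]] [c [Ac c0 Mc]]; exists (b * c).
  rewrite rpredM // mulf_neq0 //; split=> //; rewrite mulrDr; apply: MD.
    by rewrite (mulrC b) -mulrA; exact: MM.
  by rewrite -mulrA; exact: MM.
- move=> m t Mm /qT [a [b [Aa Ab b0 ->]]]; exists b; split=> //.
  by rewrite mulrCA (mulrCA b) divff // mulr1 mulrC; exact: MM.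
Qed.
End Colon.

(** * Flat overrings have comaximal denominators *)

Section Flat.
Variables (D R : idomainType) (iota : {rmorphism D -> R}).

(* For [t = a / b], flatness is tested on the inclusion of the ideal [(a, b)]
   into [D]: there [1 (x) a = t (x) b], and sending [x (x) (u a + v b)] to the
   class of [u x] modulo [(D : t)T] is well defined. *)
Section Ideal2.
Variables a b : D.

Definition ideal2_pred : {pred D^o} :=
  fun x => `[< exists uv : D * D, x = uv.1 * a + uv.2 * b >].

Lemma ideal2_submod_closed : submod_closed ideal2_pred.
Proof.
split; first by apply/asboolP; exists (0, 0); rewrite !mul0r addr0.
move=> c x y /asboolP[[u v] ->] /asboolP[[u' v'] ->]; apply/asboolP.
exists (c * u + u', c * v + v') => /=.
by rewrite /GRing.scale /= mulrDr !mulrDl !mulrA addrACA.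
Qed.
HB.instance Definition _ :=
  GRing.isSubmodClosed.Build D D^o ideal2_pred ideal2_submod_closed.

Record ideal2 := Ideal2 { ideal2_val : D^o; ideal2P : ideal2_val \in ideal2_pred }.
HB.instance Definition _ := [isSub for ideal2_val].
HB.instance Definition _ := [Choice of ideal2 by <:].
HB.instance Definition _ := [SubChoice_isSubLmodule of ideal2 by <:].

Definition ideal2_coefs (x : ideal2) : {uv : D * D | ideal2_val x = uv.1 * a + uv.2 * b}.
Proof. by apply: cid; apply/asboolP; exact: ideal2P. Qed.
End Ideal2.

Local Notation i := (in_frac iota).

Lemma flat_denominators (T : overring iota) :
  flat_overring T -> denominators_comaximal (Dsub iota) T.
Proof.
move=> flT t Tt; have [x [y [/asboolP[a ->] /asboolP[b ->] b0 tE]]] := ovr_sub Tt.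
have ibt : i b * t = i a by rewrite tE mulrC divfK.
set C := colon (Dsub iota) [set` Dsub iota] t.
(* Cancelling [b] gives [(u - u') t = v' - v], so the first coefficient is determined modulo [C]. *)
have CP u v u' v' : u * a + v * b = u' * a + v' * b -> C (i (u - u')).
  move=> uv; split; first by apply/asboolP; exists (u - u').
  apply/asboolP; exists (v' - v); apply: (mulfI b0); rewrite mulrCA ibt.
  rewrite -!rmorphM; congr (i _); apply/eqP.
  by rewrite (mulrC b) !mulrBl subr_eq addrAC eq_sym subr_eq addrC uv addrC.
pose W := smul C [set` ovr_ring T].
have [W0 WD WM] : submodule (ovr_ring T) W.
  by apply: smul_submodule; exact: submodule_ring.
have WN z : W z -> W (- z) by rewrite -mulN1r; apply: WM; rewrite rpredN rpred1.
(* [coef] rests on arbitrary choices and need not be linear, but by [CP] it is linear modulo [C],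
   which suffices modulo [W]. *)
pose coef (n : ideal2 a b) := i (sval (ideal2_coefs n)).1.
pose Phi (s : seq (ovr_mod T * ideal2 a b)) := \sum_(p <- s) ovr_val p.1 * coef p.2.
have PhiP s u : tensor_eq s u -> W (Phi s - Phi u).
  elim=> {s u}.
  - by move=> s; rewrite subrr.
  - by move=> s u _ /WN; rewrite opprB.
  - by move=> s u v _ Wsu _ Wuv; rewrite -(subrKA (Phi u)); exact: WD.
  - move=> s s' u u' _ Ws _ Wu; rewrite /Phi !big_cat /= opprD addrACA.
    exact: WD.
  - by move=> s u; rewrite /Phi !big_cat /= (addrC (\sum_(p <- u) _)) subrr.
  - by move=> n; rewrite /Phi big_seq1 big_nil mul0r subr0.
  - by move=> m m' n; rewrite /Phi big_seq1 !big_cons big_nil addr0 /= mulrDl subrr.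
  - move=> m n n'; rewrite /Phi big_seq1 !big_cons big_nil addr0 /=.
    rewrite -mulrDr -mulrBr -rmorphD -rmorphB mulrC; apply: smulM; last exact: ovr_valP.
    case: (ideal2_coefs (n + n')) (ideal2_coefs n) (ideal2_coefs n') =>
      [[u v] /= E] [[u1 v1] /= E1] [[u2 v2] /= E2].
    by apply: (CP _ v _ (v1 + v2)); rewrite -E E1 E2 !mulrDl addrACA.
  - move=> d m n; rewrite /Phi !big_seq1 /=.
    rewrite mulrAC mulrC -mulrBr -(rmorphM i) -(rmorphB i) mulrC.
    apply: smulM; last exact: ovr_valP.
    case: (ideal2_coefs (d *: n)) (ideal2_coefs n) => [[u v] /= E] [[u1 v1] /= E1].
    by apply: (CP _ (d * v1) _ v); rewrite -E E1 -!mulrA -mulrDr.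
have aP : (a : D^o) \in ideal2_pred a b.
  by apply/asboolP; exists (1, 0); rewrite mul1r mul0r addr0.
have bP : (b : D^o) \in ideal2_pred a b.
  by apply/asboolP; exists (0, 1); rewrite mul1r mul0r add0r.
pose t' : ovr_mod T := OvrMod Tt.
pose e : ovr_mod T := OvrMod (rpred1 (ovr_ring T)).
have /PhiP : tensor_eq [:: (e, Ideal2 aP)] [:: (t', Ideal2 bP)].
  have inj : injective (val : ideal2 a b -> D^o) by exact: val_inj.
  apply: (flT _ _ _ inj) => /=.
  have -> : (a : D^o) = a *: (1 : D^o) by rewrite /GRing.scale /= mulr1.
  have -> : (b : D^o) = b *: (1 : D^o) by rewrite /GRing.scale /= mulr1.
  apply: TensorTrans (TensorSym (TensorScale _ _ _)) _.
  have -> : a *: e = b *: t' by apply: val_inj; rewrite /= mulr1.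
  exact: TensorScale.
rewrite /Phi !big_seq1 /= mul1r /coef.
case: (ideal2_coefs (Ideal2 aP)) (ideal2_coefs (Ideal2 bP)) =>
  [[u v] /= E] [[u1 v1] /= E1].
move=> Wd.
(* Comparison with [a = 1 a + 0 b] and [b = 0 a + 1 b] shows that [u] is 1 and [u1] is 0 modulo [C];
   then [u - t * u1] in [W] forces 1 into [W]. *)
have C1 : C (i (1 - u)).
  by apply: (CP _ 0 _ v); rewrite -E mul1r mul0r addr0.
have C2 : C (i u1).
  by rewrite -[u1]subr0; apply: (CP _ v1 _ 1); rewrite -E1 mul1r mul0r add0r.
have -> : 1 = (i u - t * i u1) + i (1 - u) * 1 + i u1 * t.
  by rewrite rmorphB rmorph1 mulr1 (mulrC t) addrAC subrK addrC subrK.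
apply: (WD); last exact: smulM.
by apply: WD => //; apply: smulM => //; exact: rpred1.
Qed.
End Flat.

(** * Retraction and contraction of ideals to [K] *)

Lemma qf_Rsub (R : idomainType) (x : {fraction R}) : qf (Rsub R) x.
Proof.
have Rn (r : R) : tofrac r \in Rsub R by apply/asboolP; exists r.
elim/quotW: x => x; exists (tofrac (frac x).1), (tofrac (frac x).2).
have d0 : tofrac (frac x).2 != 0 by rewrite tofrac_eq0 denom_ratioP.
split=> //; apply: (canRL (mulfK d0)).
rewrite /GRing.mul /= !piE /FracField.mulf !numden_Ratio ?oner_eq0 //.
apply/eqmodP; rewrite /= FracField.equivfE.
by rewrite !numden_Ratio ?oner_eq0 ?mulr1 ?mulf_neq0 ?denom_ratioP // mulrC.
Qed.

Section Retract.
Variables (D R : idomainType) (iota : {rmorphism D -> R}) (eps : {rmorphism R -> D}).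
Hypothesis epsK : cancel iota eps.
Local Notation i := (in_frac iota).
Local Notation A := (Dsub iota).
Local Notation B := (Rsub R).
Local Notation K := (qf A).

(** Applying [eps] to [r * b = a] gives [eps r * b = a], so [r] equals [eps r] in the fraction
    field. *)
Lemma Rsub_cap_qf x : x \in B -> K x -> x \in A.
Proof.
move=> /asboolP[r ->] [_ [_ [/asboolP[a ->] /asboolP[b ->] b0 rab]]].
have /eqP : tofrac r * i b = i a by rewrite rab divfK.
rewrite -rmorphM tofrac_eq => /eqP /(congr1 eps).
rewrite rmorphM !epsK => rb; apply/asboolP; exists (eps r).
by rewrite rab -rb rmorphM mulfK.
Qed.

(** By [smul_capr], intersecting [RT] with [K] reduces to intersecting [R] with [K], where the
    retraction applies. *)
Lemma compositum_cap_qf (T : overring iota) x :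
  denominators_comaximal A T -> x \in RT T -> K x -> x \in ovr_ring T.
Proof.
move=> dT /asboolP Bx Kx.
have : smul ([set` B] `&` K) [set` ovr_ring T] x.
  apply: (smul_capr dT _ _ Bx Kx); first exact/submodule_ring/Dsub_Rsub.
  exact: submodule_qf.
apply: (smul_sub (K := [set` ovr_ring T])) => [|y z|y z] /=;
  [exact: rpred0 | exact: rpredD |].
by move=> [By Ky] Tz; apply: rpredM => //; apply: ovr_sup; exact: Rsub_cap_qf.
Qed.

(* If [IR = xR] and [b] clears the denominators of [I], then [bI] is generated
   by the image of [bx] under the retraction. *)
Lemma principal_retract (I : Defs.inv A) :
  principal B (smul I [set` B]) -> principal A I.
Proof.
have [[[I0 ID IM] IK [b [Ab b0 bI]]] _] := invP I.
move=> [x [_ _ Ix]].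
pose y (f : R) := i (eps f) / b.
(* For [w] in [I], [b * w] comes from [D], so [eps] sends [b * w * r] to [b * w * eps r]; dividing
   by [b] leaves [w * eps r] in [I]. *)
have [f bx Iy] : exists2 f, b * x = tofrac f & inv_set I (y f).
  have : smul I [set` B] x by rewrite Ix; exists 1; rewrite /= ?rpred1 ?mulr1.
  move: x {Ix}; apply: smul_sub.
  - by exists 0; rewrite /y ?mulr0 !rmorph0 // mul0r.
  - move=> u v [f bu yf] [g bv yg]; exists (f + g).
      by rewrite mulrDr bu bv rmorphD.
    by rewrite /y !rmorphD mulrDl; exact: ID.
  - move=> w _ Iw /asboolP[r ->]; have /asboolP[e bw] := bI _ Iw.
    exists (iota e * r); first by rewrite mulrA bw rmorphM.
    have -> : y (iota e * r) = i (eps r) * w.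
      by rewrite /y rmorphM epsK (rmorphM i) -bw mulrAC (mulrC b) mulfK // mulrC.
    by apply: IM => //; apply/asboolP; exists (eps r).
have IE : inv_set I = cyclic_mod A (y f).
  apply/seteqP; split=> [w Iw|_ [a /= Aa <-]]; last by rewrite mulrC; exact: IM.
  have : smul I [set` B] w by exact: sub_ext.
  rewrite Ix => -[_ /asboolP[c ->] wc]; have /asboolP[e bw] := bI _ Iw.
  have : tofrac f * tofrac c = tofrac (iota e) by rewrite -bx -mulrA wc bw.
  rewrite -rmorphM => /eqP; rewrite tofrac_eq => /eqP /(congr1 eps).
  rewrite rmorphM epsK => fc; exists (i (eps c)); first by apply/asboolP; exists (eps c).
  by rewrite /y mulrAC -(rmorphM i) fc -bw (mulrC b) mulfK.
exists (y f); split=> //; first exact: IK.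
have [w Iw] := inv_neq0 I; apply: contraNneq => y0.
by move: Iw; rewrite IE y0 => -[c _ <-]; rewrite mul0r.
Qed.

Hypothesis B_pp : pseudo_polynomial B A.

(** A suitable nonzero multiple of [g] by an element of [D] lies in [R] and divides a nonzero
    element of [D] there. Pseudo-polynomiality replaces it by some [a] in [D], and the multiplier is
    then divided out. *)
Lemma RT_generator (T : overring iota) (J J' : set {fraction R}) g d d' :
  fractional B J -> smul J J' = [set` B] ->
  d \in A -> d != 0 -> J d -> d' \in A -> d' != 0 -> J' d' ->
  smul J [set` RT T] = cyclic_mod (RT T) g ->
  exists a, [/\ K a, a != 0 & smul J [set` RT T] = cyclic_mod (RT T) a].
Proof.
move=> fJ JJ' Ad d0 Jd Ad' d'0 Jd' JE.
have sB : submodule A [set` B] by exact/submodule_ring/Dsub_Rsub.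
have [h /= Rh ghd] : cyclic_mod (RT T) g d by rewrite -JE; exact: sub_ext.
have gd' : g * d' \in RT T.
  have : smul J [set` RT T] g.
    by rewrite JE; exists 1; rewrite /= ?rpred1 ?mulr1.
  move=> /smulM /(_ Jd'); rewrite smulC smulA (smulC J') JJ'.
  by rewrite smul_ringl //; exact: Rsub_RT.
have cl z : z \in RT T -> exists t, [/\ t \in A, t != 0 & t * z \in B].
  by move=> /asboolP; apply: clear_denominator => //; exact: ovr_sub.
have [t [At t0 tp]] := cl _ gd'; have [u [Au u0 uh]] := cl _ Rh.
have g0 : g != 0 by apply: contraNneq d0 => g0; rewrite -ghd g0 mul0r.
have [|a Aa aE] := B_pp tp.
  (* Since [d = g * h], this is [(t * (g * d')) * (u * h)], a multiple in [R] of the chosen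
     element. *)
  exists (t * u * (d * d')); split.
  - by exists (u * h) => //; rewrite mulrACA -ghd (mulrAC g).
  - by apply: qf_ring; rewrite !rpredM.
  - by rewrite !mulf_neq0.
have a0 : a != 0.
  apply/negP => /eqP a0; have : cyclic_mod B a (t * (g * d')).
    by rewrite -aE; exists 1; rewrite /= ?rpred1 ?mulr1.
  rewrite a0 => -[c _ /eqP].
  by rewrite mul0r eq_sym !mulf_eq0 (negPf t0) (negPf g0) (negPf d'0).
exists (a / (t * d')); split.
- by apply: qfM; [exact: qf_ring | apply: qfV; apply: qf_ring; exact: rpredM].
- by rewrite mulf_neq0 ?invr_eq0 ?mulf_neq0.
- rewrite JE -smul_cyclic -(cyclic_ext a (@Rsub_RT _ _ iota T)) -aE cyclic_ext.
    by rewrite smul_cyclic; congr cyclic_mod; rewrite mulrCA mulfK // mulf_neq0.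
  exact: Rsub_RT.
Qed.

Lemma ovr_RT (T : overring iota) : {subset ovr_ring T <= RT T}.
Proof.
move=> x Tx; apply/asboolP; rewrite -[x]mul1r.
by apply: smulM => //=; exact: rpred1.
Qed.

Lemma smul_Rsub_ovr (T : overring iota) : smul [set` B] [set` ovr_ring T] = [set` RT T].
Proof. by apply/seteqP; split=> x /asboolP. Qed.

(** Elements of [(J \cap K)T] divided by [a] lie in [RT \cap K = T]. Conversely [a] lies in
    [JRT = JT] and in [K], so [smul_capr] puts it in [(J \cap K)T]. *)
Lemma contraction_ext (T : overring iota) (J : set {fraction R}) a :
  denominators_comaximal A T -> fractional B J -> K a -> a != 0 ->
  smul J [set` RT T] = cyclic_mod (RT T) a ->
  smul (J `&` K) [set` ovr_ring T] = cyclic_mod T a.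
Proof.
move=> dT fJ Ka a0 JE.
have sJ : submodule A J.
  by case: fJ => [[J0 JD JM] _ _]; split=> // c x /(@Dsub_Rsub _ _ iota); exact: JM.
have JRT : smul J [set` RT T] = smul J [set` ovr_ring T].
  by rewrite -[in RHS](smul_fractional fJ) -smulA smul_Rsub_ovr.
apply/seteqP; split.
  apply: smul_sub.
  - by exists 0; rewrite ?mulr0 //= rpred0.
  - move=> _ _ [b /= Tb <-] [c /= Tc <-].
    by exists (b + c); rewrite /= ?rpredD ?mulrDr.
  - move=> x y [Jx Kx] /= Ty; exists (a^-1 * (x * y)); last by rewrite mulVKf.
    apply: (compositum_cap_qf dT).
      have : smul J [set` RT T] (x * y) by apply: smulM => //=; exact: ovr_RT.
      by rewrite JE => -[c Rc <-]; rewrite mulKf.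
    apply: qfM; first exact: qfV.
    by apply: qfM => //; exact: (ovr_sub Ty).
move=> _ [t /= Tt <-]; rewrite -smul_ringr_id; apply: smulM => //.
apply: (smul_capr dT) => //; first exact: submodule_qf.
by rewrite -JRT JE; exists 1; rewrite /= ?rpred1 ?mulr1.
Qed.

(** * Completeness and the kernel of the extension map *)

Variable Theta : set (overring iota).
Hypothesis Theta_flat : forall T, Theta T -> flat_overring T.
Hypothesis Theta_complete : complete Theta.

(** An empty intersection is the whole field, which is not the zero ideal. *)
Lemma complete_nonempty : exists T, Theta T.
Proof.
apply: contrapT => noT.
have /Theta_complete E : integral A (cyclic_mod A 0).
  split; first by apply: fractional_cyclic; exact: qf0.
  by move=> _ [c _ <-] /=; rewrite mul0r rpred0.
have : cyclic_mod A 0 1 by rewrite E => T TT; case: noT; exists T.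
by move=> [c _ /eqP]; rewrite mul0r eq_sym oner_eq0.
Qed.

(** Completeness is applied to the ideal [(M : x)], which generates every [T] in [Theta] and hence
    contains 1. *)
Lemma complete_submodule (M : set {fraction R}) x : submodule A M ->
  (forall T, Theta T -> smul M [set` ovr_ring T] x) -> M x.
Proof.
move=> sM Mx; suff : colon A M x 1 by case; rewrite mul1r.
rewrite (Theta_complete (colon_ideal x sM)) => T TT.
by apply: colon_comaximal => //; [exact/flat_denominators/Theta_flat | exact: Mx].
Qed.

Lemma fractional_contraction (J J' : set {fraction R}) d :
  fractional B J -> smul J J' = [set` B] -> d \in A -> d != 0 -> J' d ->
  fractional A (J `&` K).
Proof.
move=> [[J0 JD JM] _ _] JJ' Ad d0 J'd; split.
- apply: submoduleI; last exact: submodule_qf.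
  by split=> // c x /(@Dsub_Rsub _ _ iota); exact: JM.
- by move=> x [].
- exists d; split=> // x [Jx Kx]; apply: Rsub_cap_qf.
    by have := smulM Jx J'd; rewrite JJ' mulrC.
  by apply: qfM => //; exact: qf_ring.
Qed.

(** Besides feeding [RT_generator], [d'] is a common denominator for [J \cap K] and [d] for
    [J^-1 \cap K]. *)
Lemma ext_contraction (J : Defs.inv B) d d' :
  d \in A -> d != 0 -> inv_set J d ->
  d' \in A -> d' != 0 -> inv_set (- J) d' ->
  (forall T, Theta T -> principal (RT T) (smul J [set` RT T])) ->
  exists I : Defs.inv A,
    (forall T, Theta T -> principal T (smul I [set` ovr_ring T])) /\
    smul I [set` B] = J.
Proof.
move=> Ad d0 Jd Ad' d'0 Jd' Jp.
set J' := inv_set (- J) in Jd'.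
have JJ' : smul J J' = [set` B] by exact: (congr1 (@inv_set _ B) (subrr J)).
have J'J : smul J' J = [set` B] by rewrite smulC.
have [fJ _] := invP J; have [fJ' _] := invP (- J).
have dT T : Theta T -> denominators_comaximal A T.
  by move=> /Theta_flat; exact: flat_denominators.
pose I : set {fraction R} := inv_set J `&` K.
pose I' : set {fraction R} := J' `&` K.
have fI : fractional A I := fractional_contraction fJ JJ' Ad' d'0 Jd'.
have fI' : fractional A I' := fractional_contraction fJ' J'J Ad d0 Jd.
have loc T : Theta T -> exists a, [/\ K a, a != 0,
    smul J [set` RT T] = cyclic_mod (RT T) a,
    smul I [set` ovr_ring T] = cyclic_mod T a &
    smul I' [set` ovr_ring T] = cyclic_mod T a^-1].
  move=> TT; have [g [_ _ JE]] := Jp _ TT.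
  have [a [Ka a0 aE]] := RT_generator fJ JJ' Ad d0 Jd Ad' d'0 Jd' JE.
  exists a; split=> //; first exact: contraction_ext (dT _ TT) fJ Ka a0 aE.
  apply: contraction_ext (dT _ TT) fJ' (qfV Ka) _ _; first by rewrite invr_eq0.
  have JJ'T : smul (smul J [set` RT T]) (smul J' [set` RT T]) = [set` RT T].
    by rewrite (smul_ext _ _ (@Rsub_RT _ _ iota T)) JJ' smul_ringl //; exact: Rsub_RT.
  (* Inserting [a^-1 * a] and writing [a RT] as [JRT] turns [J'RT] into [a^-1 JJ'RT = a^-1 RT]. *)
  have -> : smul J' [set` RT T] =
      smul (cyclic_mod (RT T) (a^-1 * a)) (smul J' [set` RT T]).
    by rewrite mulVf // cyclic_mod1 [RHS]smulC smul_ringr_id.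
  rewrite -smul_cyclic -aE -smulA JJ'T; apply/smul_fractional/fractional_cyclic.
  have /qf_mono KRT : {subset A <= RT T} by move=> y /Dsub_Rsub; exact: Rsub_RT.
  by apply: qfV; exact: KRT.
have II' : smul I I' = [set` A].
  apply/seteqP; split.
    apply: smul_sub => [|x y|x y [Jx Kx] [Jy Ky]] /=; [exact: rpred0 | exact: rpredD |].
    apply: Rsub_cap_qf; last exact: qfM.
    by have := smulM Jx Jy; rewrite JJ'.
  have sII' : submodule A (smul I I').
    exact/smul_submodule/fractional_submodule.
  have II1 : smul I I' 1.
    apply: complete_submodule => // T TT; have [a [_ a0 _ IE IE']] := loc _ TT.
    have /= <- := smul_ext I I' (@ovr_sup _ _ iota T).
    rewrite IE IE' smul_cyclic divff //; exists 1; rewrite /= ?rpred1 ?mulr1 //.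
  by case: sII' => _ _ + x Ax => /(_ _ _ Ax II1); rewrite mulr1.
have iI : invertible A I by split=> //; exists I'.
exists (Inv iI); split=> /= [T TT|].
  have [a [Ka a0 _ IE _]] := loc _ TT; exists a; split=> //.
  exact: qf_mono (@ovr_sup _ _ iota T) _ Ka.
apply/seteqP; split.
  rewrite -[X in _ `<=` X](smul_fractional fJ).
  by apply: smul_mono => // x [].
have sB : submodule A [set` B] by exact/submodule_ring/Dsub_Rsub.
move=> x Jx; apply: complete_submodule; first exact: smul_submodule.
move=> T TT; have [a [_ a0 JE IE _]] := loc _ TT.
(* Locally [(IR)T = (IT)(RT) = a RT = JRT], which contains [x]. *)
rewrite -smulA smul_Rsub_ovr -(smul_ringl (@ovr_RT T)) smulA IE.
by rewrite (cyclic_ext _ (@ovr_RT T)) -JE; exact: sub_ext.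
Qed.

Lemma cyclic_invertible x : x != 0 -> invertible B (cyclic_mod B x).
Proof.
move=> x0; split; first exact/fractional_cyclic/qf_Rsub.
exists (cyclic_mod B x^-1); first exact/fractional_cyclic/qf_Rsub.
by rewrite smul_cyclic divff // cyclic_mod1.
Qed.

(** The ideal [f^-1 J], written [J + F], becomes trivial over [RT0]. It and its inverse then meet
    [D] nontrivially, so it is itself extended from [D]. *)
Lemma kernel_contraction (J : Defs.inv B) :
  (forall T, Theta T -> principal (RT T) (smul J [set` RT T])) ->
  exists I : Defs.inv A,
    (forall T, Theta T -> principal T (smul I [set` ovr_ring T])) /\
    inv_ext (@Dsub_Rsub _ _ iota) I - J \in Princ B.
Proof.
move=> Jp; have [T0 TT0] := complete_nonempty.
have [f [_ f0 fE]] := Jp _ TT0.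
have fV0 : f^-1 != 0 by rewrite invr_eq0.
pose F := Inv (cyclic_invertible fV0).
have Fp : F \in Princ B by apply/asboolP; exists f^-1; split=> //; exact: qf_Rsub.
pose e T : {additive Defs.inv B -> Defs.inv (RT T)} := inv_ext (@Rsub_RT _ _ iota T).
have e0 : e T0 (J + F) = 0.
  rewrite raddfD; apply: Defs.inv_inj; rewrite inv_setD /= fE.
  rewrite cyclic_ext; last exact: Rsub_RT.
  by rewrite smul_cyclic divff // cyclic_mod1.
(* Triviality over [RT0] puts 1 in [M T0]; a denominator of this 1 relative to [M] is an element of
   [M]. *)
have dE (M : Defs.inv B) : e T0 M = 0 -> exists d, [/\ d \in A, d != 0 & inv_set M d].
  move=> /(congr1 (@inv_set _ _)) /= ME; have [fM _] := invP M.
  have M1 : smul M [set` ovr_ring T0] 1.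
    rewrite -(smul_fractional fM) -smulA smul_Rsub_ovr ME; exact: rpred1.
  have sM : submodule A M.
    by case: fM => [[M0 MD MM] _ _]; split=> // c x /(@Dsub_Rsub _ _ iota); exact: MM.
  have [d] := clear_denominator sM (@ovr_sub _ _ _ T0) M1.
  by rewrite mulr1; exists d.
have [d [Ad d0 Jd]] := dE _ e0.
have [|d' [Ad' d'0 Jd']] := dE (- (J + F)); first by rewrite raddfN e0 oppr0.
have [T TT|I [Ip IE]] := ext_contraction Ad d0 Jd Ad' d'0 Jd'.
  suff /asboolP : e T (J + F) \in Princ (RT T) by [].
  rewrite raddfD rpredD //; first exact/asboolP/Jp.
  exact: inv_ext_princ.
exists I; split=> //.
have -> : inv_ext (@Dsub_Rsub _ _ iota) I = J + F by apply: Defs.inv_inj; exact: IE.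
by rewrite addrC addKr.
Qed.

Lemma ext_principal (I : Defs.inv A) (T : overring iota) :
  principal T (smul I [set` ovr_ring T]) ->
  principal (RT T) (smul (smul I [set` B]) [set` RT T]).
Proof.
move=> /(principal_ext (@ovr_RT T)).
by rewrite -!smulA smul_ringl ?smul_ringl //; [exact: Rsub_RT | exact: ovr_RT].
Qed.

End Retract.

(** * The two exact sequences *)

Lemma quot_pi0 (V : zmodType) (P : zmodClosed V) (x : V) :
  (\pi_(Quotient.quot P) x = 0) <-> x \in P.
Proof.
rewrite -[X in X \in _](subr0 x) Quotient.idealrBE raddf0.
by split=> [->|/eqP].
Qed.

Theorem theorem7p1 (D R : idomainType) (iota : {rmorphism D -> R})
    (D_not_field : exists d : D, d != 0 /\ d \isn't a GRing.unit)
    (R_retract : retract_algebra iota)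
    (R_pseudo_polynomial : pseudo_polynomial (Rsub R) (Dsub iota))
    (Theta : set (overring iota))
    (Theta_flat : forall T, Theta T -> flat_overring T)
    (Theta_complete : complete Theta) :
  left_exact (ext_R Theta) (pi_Theta Theta) /\
  left_exact (ext_R_u Theta) (pi_Theta_u Theta).
Proof.
case: R_retract => eps epsK.
have PicP (c : Pic_Theta Theta) : exists I : Defs.inv (Dsub iota),
    subgrp_val c = \pi_(Pic (Dsub iota)) I /\
    forall T, Theta T -> principal T (smul I [set` ovr_ring T]).
  by case: c => c /= /asboolP[I -> Ip]; exists I.
have mem (I : Defs.inv (Dsub iota)) :
    (forall T, Theta T -> principal T (smul I [set` ovr_ring T])) ->
    \pi_(Pic (Dsub iota)) I \in Pic_Theta_sub Theta.
  by move=> Ip; apply/asboolP; exists I.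
split; split.
- apply: raddf_inj => c; have [I [cI _]] := PicP c.
  rewrite /= cI Pic_extE => /quot_pi0/asboolP/(principal_retract epsK) Ip.
  by apply: val_inj; rewrite /= cI; apply/quot_pi0/asboolP.
- elim/quotW => J; split.
    move=> J0; have Jp T : Theta T -> principal (RT T) (smul J [set` RT T]).
      move=> TT; have := congr1 (fun x => x (exist _ T (mem_set TT))) J0.
      by rewrite /= /prod_map /= Pic_extE => /quot_pi0/asboolP.
    have [I [Ip IJ]] :=
      kernel_contraction epsK R_pseudo_polynomial Theta_flat Theta_complete Jp.
    exists (Subgrp (mem _ Ip)); rewrite /= Pic_extE.
    by apply/eqP; rewrite -Quotient.idealrBE.
  move=> [c <-]; have [I [cI Ip]] := PicP c.
  apply: functional_extensionality_dep => -[T TT].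
  have -> : ext_R Theta c = \pi_(Pic (Rsub R)) (inv_ext (@Dsub_Rsub _ _ iota) I).
    by rewrite /= cI Pic_extE.
  apply: etrans (Pic_extE _ _) _; apply/quot_pi0/asboolP.
  by apply: ext_principal; apply: Ip; exact: set_mem.
(* A class in [Pic_u] vanishes exactly when its underlying ideal is principal, so the second
   sequence follows from the same lemmas. *)
- apply: raddf_inj => c; have [I [cI _]] := PicP c.
  rewrite /= cI Pic_to_uE => /quot_pi0/asboolP/(principal_retract epsK) Ip.
  by apply: val_inj; rewrite /= cI; apply/quot_pi0/asboolP.
- elim/quotW => J; split.
    move=> J0; have Jp T : Theta T -> principal (RT T) (smul (subgrp_val J) [set` RT T]).
      move=> TT; have := congr1 (fun x => x (exist _ T (mem_set TT))) J0.
      by rewrite /= /prod_map /= Pic_u_extE => /quot_pi0/asboolP.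
    have [I [Ip IJ]] :=
      kernel_contraction epsK R_pseudo_polynomial Theta_flat Theta_complete Jp.
    exists (Subgrp (mem _ Ip)); rewrite /= Pic_to_uE.
    by apply/eqP; rewrite -Quotient.idealrBE.
  move=> [c <-]; have [I [cI Ip]] := PicP c.
  apply: functional_extensionality_dep => -[T TT].
  have -> : ext_R_u Theta c =
      \pi_(Pic_u (Rsub R) (Dsub iota)) (inv_to_u (@Dsub_Rsub _ _ iota) I).
    by rewrite /= cI Pic_to_uE.
  apply: etrans (Pic_u_extE _ _ _) _; apply/quot_pi0/asboolP.
  by apply: ext_principal; apply: Ip; exact: set_mem.
Qed.
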